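(* Let $\mathcal{S}=\langle a_1,a_2,a_3\rangle\subset\mathbb{N}$ be a numerical semigroup minimally generated by $\{a_1,a_2,a_3\}$ such that $d\,a_1\in\langle a_2,a_3\rangle$, where $d:=\gcd\{a_2,a_3\}$. For $x\in\mathbb{Z}$ let $\alpha(x)$ be the unique element of $\{0,\ldots,d-1\}$ such that $\alpha(x)\,a_1\equiv x\pmod d$. Then, for all $x\in\mathbb{Z}$, $\mu_{\mathcal{S}}(x)=0$ if $\alpha(x)\geq2$, and otherwise $$\mu_{\mathcal{S}}(x)=(-1)^{\alpha(x)}\left(d_B(x')-d_B(x'-a_2)-d_B(x'-a_3)+d_B(x'-a_2-a_3)\right),$$ where $x':=x-\alpha(x)\,a_1$ and $B:=(d\,a_1,\ a_2a_3/d)$.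
   Context: $\mathbb{N}=\{0,1,2,\ldots\}$. For positive integers $a_1,\ldots,a_n$, $\langle a_1,\ldots,a_n\rangle=\{x_1a_1+\cdots+x_na_n\mid x_1,\ldots,x_n\in\mathbb{N}\}$; it is a numerical semigroup if $\gcd\{a_1,\ldots,a_n\}=1$. It is minimally generated by $\{a_1,a_2,a_3\}$ if the three generators are distinct and no proper subset of them generates it. For $\mathcal{S}=\langle a_1,a_2,a_3\rangle$, the relation $x\leq_{\mathcal{S}}y\iff y-x\in\mathcal{S}$ is a locally finite partial order on $\mathbb{Z}$. For $l\ge0$ let $c_l(x,y)$ be the number of chains $x=z_0<_{\mathcal{S}}z_1<_{\mathcal{S}}\cdots<_{\mathcal{S}}z_l=y$ of length $l$ in $\mathbb{Z}$; the Möbius function of $\mathcal{S}$ is $\mu_{\mathcal{S}}(x):=\sum_{l\ge0}(-1)^lc_l(0,x)$ for $x\in\mathbb{Z}$ (a finite sum). For a tuple $B=(b_1,\ldots,b_k)$ of positive integers and $y\in\mathbb{Z}$, $d_B(y)$ denotes the number of $(x_1,\ldots,x_k)\in\mathbb{N}^k$ with $y=\sum_{i=1}^kx_ib_i$. *)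

(* Defs.v *)
From HB Require Import structures.
From mathcomp Require Import all_boot all_order all_algebra finmap.
From mathcomp Require Import mathcomp_extra boolp classical_sets functions.
From mathcomp Require Import cardinality fsbigop.

Set Implicit Arguments.
Unset Strict Implicit.
Unset Printing Implicit Defensive.

Import Order.TTheory GRing.Theory Num.Theory.

Local Open Scope classical_set_scope.
Local Open Scope ring_scope.

Definition representations (b : seq nat) (y : int) : set ((size b).-tuple nat) :=
  [set x | y = (\sum_(i < size b) tnth x i * nth 0%N b i)%N%:Z].
Arguments representations : clear implicits.

(* [fset_set A] is empty when [A] is infinite; the set counted here is finite
   as soon as the entries of [b] are positive (finite_representations). *)
Definition denumerant (b : seq nat) (y : int) : nat :=
  #|` fset_set (representations b y)|%fset.

(* The semigroup <b> is viewed inside int. *)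
Definition semigroup (b : seq nat) : set int :=
  [set y | representations b y !=set0].

(* [b] stands for the set of its entries, so order and repetitions in it are
   irrelevant. *)
Definition minimal_generators (a : seq nat) : Prop :=
  uniq a /\
  forall b : seq nat, {subset b <= a} -> ~ {subset a <= b} ->
    semigroup b <> semigroup a.

Definition sle (S : set int) (x y : int) : Prop := S (y - x).
Definition slt (S : set int) (x y : int) : Prop := sle S x y /\ x <> y.

Definition chains (S : set int) (l : nat) (x y : int) : set (l.+1.-tuple int) :=
  [set z | [/\ z`_0 = x, z`_l = y &
             forall i, (i < l)%N -> slt S z`_i z`_i.+1]].
Arguments chains : clear implicits.

(* Finite when S contains only nonnegative integers (finite_chains). *)
Definition nchains (S : set int) (l : nat) (x y : int) : nat :=
  #|` fset_set (chains S l x y)|%fset.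

(* The sum over all l is a finitely supported sum, worth 0 by convention if
   the support is infinite; it never is for S contained in the nonnegative
   integers (finite_nchains_support). *)
Definition mobius (S : set int) (x : int) : int :=
  \sum_(l \in [set: nat]) (-1) ^+ l * (nchains S l 0 x)%:Z.

Lemma finite_representations (b : seq nat) (y : int) :
  all (leq 1) b -> finite_set (representations b y).
Proof.
move=> b0.
pose n := `|y|%N.
apply: (@sub_finite_set _ _
  ((fun t : (size b).-tuple 'I_n.+1 => [tuple of map val t]) @` setT)).
  move=> x /= xy; exists [tuple of map inord x] => //.
  apply/val_inj => /=; rewrite -map_comp -[RHS]map_id.
  apply/eq_in_map => k /tnthP[i ->] /=; rewrite inordK// ltnS /n xy absz_nat.
  rewrite (bigD1 i)//=; apply: leq_trans (leq_addr _ _).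
  by apply: leq_pmulr; apply: (allP b0); apply: mem_nth.
exact/finite_image/finite_finset.
Qed.

Lemma semigroup_ge0 (b : seq nat) (y : int) : semigroup b y -> 0 <= y.
Proof. by case=> x ->. Qed.

Lemma chain_bound (S : set int) l x y (z : l.+1.-tuple int) :
  (forall s, S s -> 0 <= s) -> chains S l x y z ->
  forall i, (i <= l)%N -> x + i%:Z <= z`_i /\ z`_i + (l - i)%:Z <= y.
Proof.
move=> S0 [z0 zl zlt].
have step i : (i < l)%N -> z`_i + 1 <= z`_i.+1.
  move=> /zlt[/S0]; rewrite subr_ge0 => h1 h2.
  by rewrite lezD1 lt_neqAle h1 andbT; apply/eqP.
move=> i il; split.
  elim: i il => [|i IH] il; first by rewrite z0 addr0.
  apply: le_trans (step i il).
  by rewrite -(addn1 i) PoszD addrA lerD2r IH// ltnW.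
have {il} : exists k, (k <= l)%N /\ i = (l - k)%N.
  by exists (l - i)%N; rewrite leq_subr subKn.
case=> k [kl ->]; rewrite subKn//.
elim: k kl => [|k IH] kl; first by rewrite subn0 addr0 zl.
apply: le_trans (IH (ltnW kl)).
rewrite -(add1n k) PoszD addrA lerD2r.
have -> : z`_(l - k) = z`_(l - k.+1).+1 by rewrite subnSK.
apply: step; by rewrite ltn_subrL /= (leq_ltn_trans _ kl).
Qed.

Lemma finite_chains (S : set int) l x y :
  (forall s, S s -> 0 <= s) -> finite_set (chains S l x y).
Proof.
move=> S0; pose n := `|y - x|%N.
apply: (@sub_finite_set _ _
  ((fun t : l.+1.-tuple 'I_n.+1 =>
      [tuple of map (fun k : 'I_n.+1 => x + k%:Z) t]) @` setT)).
  move=> z /= zc; exists [tuple of map (fun k => inord `|k - x|%N) z] => //.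
  apply/val_inj => /=; rewrite -map_comp -[RHS]map_id.
  apply/eq_in_map => k /tnthP[i ->] /=; rewrite (tnth_nth 0).
  have [h1 h2] := chain_bound S0 zc (ltn_ord i : (i <= l)%N).
  have {}h1 : x <= z`_i by apply: le_trans h1; rewrite lerDl.
  have {}h2 : z`_i <= y by apply: le_trans h2; rewrite lerDl.
  rewrite inordK; first by rewrite gez0_abs ?subr_ge0// addrCA subrr addr0.
  rewrite ltnS /n -lez_nat !gez0_abs ?subr_ge0// ?lerD2r//.
  exact: le_trans h2.
exact/finite_image/finite_finset.
Qed.

Lemma finite_nchains_support (S : set int) x :
  (forall s, S s -> 0 <= s) ->
  finite_set [set l | (-1) ^+ l * (nchains S l 0 x)%:Z != 0].
Proof.
move=> S0; apply: (@sub_finite_set _ _ `I_(`|x|.+1)); last exact: finite_II.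
move=> l /=; apply: contra_neqT; rewrite -leqNgt => lx.
suff E : chains S l 0 x = set0 by rewrite /nchains E fset_set0 cardfs0 mulr0.
rewrite -subset0 => z zc.
have [_ h] := chain_bound S0 zc (leq0n l).
have z0 : z`_0 = 0 by case: zc.
move: h lx; rewrite z0 add0r subn0 => h; rewrite ltnNge => /negP; apply.
by rewrite -lez_nat (le_trans h)// ler_norm.
Qed.

(* Main.v *)
(* Write [D_a f x = f x - f (x - a)], i.e. multiplication of the power series
   of [f] by [1 - t ^ a].  Let [T = <a2, a3>] and [L = lcm(a2, a3)].  The
   multiples of [a1] that are differences of elements of [T] are those of
   [d a1], which lies in [T]; likewise for [a2], [<a3>] and [L].  So the
   indicator functions satisfy [D_a1 1_S = D_(d a1) 1_T],
   [D_a2 1_T = D_L 1_<a3>] and [D_a3 1_<a3> = delta].  Since the Moebius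
   function is the convolution inverse of [1_S], this gives
   [D_a1 D_a2 D_a3 delta = D_(d a1) D_L mu], whereas
   [D_(d a1) D_L d_B = delta]; cancelling, [mu = D_a1 D_a2 D_a3 d_B].
   Finally [d_B] is supported on the multiples of [d], and so is
   [D_a2 D_a3 d_B]; hence at most one of [x] and [x - a1] contributes,
   according to the residue [alpha x]. *)

Require Import Defs.
From HB Require Import structures.
From mathcomp Require Import all_boot all_order all_algebra finmap.
From mathcomp Require Import mathcomp_extra boolp classical_sets functions.
From mathcomp Require Import cardinality fsbigop.
From mathcomp Require Import zify ring.

Set Implicit Arguments.
Unset Strict Implicit.
Unset Printing Implicit Defensive.

Import Order.TTheory GRing.Theory Num.Theory.

Local Open Scope classical_set_scope.
Local Open Scope ring_scope.

(** * Power series as functions on the integers: differences and convolution *)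

Definition delta (x : int) : int := (x == 0)%:R.

Definition zeta (A : set int) (x : int) : int := (x \in A)%:R.

(* Functions [int -> int] vanishing on negative integers stand for formal power
   series: [diff a] is multiplication by [1 - t ^ a] and [conv] the product. *)
Definition causal (f : int -> int) := forall x, x < 0 -> f x = 0.

Definition diff (a : nat) (f : int -> int) (x : int) : int :=
  f x - f (x - a%:Z).

Definition conv (f g : int -> int) (x : int) : int :=
  \sum_(i < `|x|.+1) f i%:Z * g (x - i%:Z).

Lemma causal_delta : causal delta.
Proof. by move=> x x0; rewrite /delta lt_eqF. Qed.

Lemma causal_diff a f : causal f -> causal (diff a f).
Proof. by move=> cf x x0; rewrite /diff !cf ?subrr//; lia. Qed.

Lemma diffC a b f : diff a (diff b f) = diff b (diff a f).
Proof.
apply/funext => x; rewrite /diff [x - b%:Z - a%:Z]addrAC.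
ring.
Qed.

(** Cancellation of [1 - t ^ a]: the value at [x] is recovered from the one at [x - a], and the
    descent ends among negative integers, where both functions vanish. *)
Lemma diff_inj a f g : (0 < a)%N -> causal f -> causal g ->
  diff a f = diff a g -> f = g.
Proof.
move=> a0 cf cg fg; apply/funext => x.
have [n] : exists n : nat, x < n%:Z by exists `|x|.+1; lia.
elim: n x => [|n IH] x xn; first by rewrite cf ?cg.
have := congr1 (@^~ x) fg; rewrite /diff (IH (x - a%:Z)); last by lia.
exact: addIr.
Qed.

(** Terms with [i > x] vanish because [g] is causal, so every bound above [x] gives the same sum.
    This puts convolutions at different points on a common range. *)
Lemma conv_widen f g x (n : nat) : causal g -> x < n%:Z ->
  conv f g x = \sum_(i < n) f i%:Z * g (x - i%:Z).
Proof.
move=> cg.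
have wid (m p : nat) : (m <= p)%N -> x < m%:Z ->
    \sum_(i < p) f i%:Z * g (x - i%:Z) = \sum_(i < m) f i%:Z * g (x - i%:Z).
  move=> mp xm; rewrite (@big_ord_widen _ _ _ m p
      (fun i => f i%:Z * g (x - i%:Z)))//.
  rewrite [LHS](bigID (fun i : 'I_p => (i < m)%N))/= [X in _ + X]big1 ?addr0//.
  by move=> i im; rewrite cg ?mulr0//; lia.
move=> xn; rewrite /conv -(wid _ (maxn `|x|.+1 n)) ?leq_maxl//; last by lia.
by rewrite (wid n) ?leq_maxr.
Qed.

Lemma conv_delta g : causal g -> conv delta g = g.
Proof.
move=> cg; apply/funext => x.
rewrite /conv big_ord_recl /delta eqxx mul1r subr0 big1 ?addr0// => i _.
by rewrite (_ : (_ == 0) = false) ?mul0r.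
Qed.

Lemma conv_diffl a f g : causal f -> causal g ->
  conv (diff a f) g = diff a (conv f g).
Proof.
move=> cf cg; apply/funext => x; rewrite /diff.
set n := `|x|.+1.
have xn : x < (a + n)%:Z by lia.
rewrite !(conv_widen _ cg xn) (@conv_widen f g (x - a%:Z) n)//; last by lia.
under eq_bigr do rewrite mulrBl.
rewrite sumrB; congr (_ - _).
(* In the shifted sum the first [a] terms evaluate [f] at negative integers; reindexing the other
   [n] gives the convolution at [x - a]. *)
rewrite big_split_ord/= big1 ?add0r.
  by apply: eq_bigr => i _; congr (f _ * g _); lia.
by move=> i _; rewrite cf ?mul0r//; have := ltn_ord i; lia.
Qed.

(** * Semigroups and the effect of adjoining a generator *)

Lemma representations_cons a b y k (t : (size b).-tuple nat) :
  representations (a :: b) y [tuple of k :: t] <->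
  representations b (y - (k * a)%N%:Z) t.
Proof.
rewrite /representations /= big_ord_recl tnth0 /=.
under eq_bigr do rewrite tnthS add0n.
by rewrite /mkset; split; lia.
Qed.

Lemma semigroup_nil y : semigroup [::] y <-> y = 0.
Proof.
split; first by case=> x; rewrite /representations/= big_ord0.
by move=> ->; exists [tuple]; rewrite /representations/= big_ord0.
Qed.

Lemma semigroup_cons a b y :
  semigroup (a :: b) y <-> exists k : nat, semigroup b (y - (k * a)%N%:Z).
Proof.
split.
  case; case/tupleP=> k t /representations_cons ?; exists k; by exists t.
by case=> k [t] ?; exists [tuple of k :: t]; apply/representations_cons.
Qed.

Lemma semigroup0 b : semigroup b 0.
Proof.
elim: b => [|a b IH]; first exact/semigroup_nil.
by apply/semigroup_cons; exists 0%N.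
Qed.

Lemma semigroupD b x y : semigroup b x -> semigroup b y -> semigroup b (x + y).
Proof.
elim: b x y => [|a b IH] x y.
  by move=> /semigroup_nil-> /semigroup_nil->; apply/semigroup_nil.
move=> /semigroup_cons[k xk] /semigroup_cons[l yl].
apply/semigroup_cons; exists (k + l)%N.
by have := IH _ _ xk yl; congr (semigroup b _); lia.
Qed.

Lemma semigroupMn b (x : nat) n :
  semigroup b x%:Z -> semigroup b (n * x)%N%:Z.
Proof.
move=> bx; elim: n => [|n IH]; first exact: semigroup0.
by rewrite mulSn PoszD; apply: semigroupD.
Qed.

Lemma semigroup_dvd (d : nat) b : all (dvdn d) b ->
  forall y, semigroup b y -> (d%:Z %| y)%Z.
Proof.
elim: b => [_ y /semigroup_nil ->|a b IH /= /andP[da db] y]; first exact: dvdz0.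
case/semigroup_cons => k /(IH db) dy.
rewrite -(subrK (k * a)%N%:Z y) rpredD//.
by rewrite dvdzE dvdn_mull.
Qed.

Lemma causal_zeta b : causal (zeta (semigroup b)).
Proof.
move=> x x0; rewrite /zeta memNset// => /semigroup_ge0.
by rewrite leNgt x0.
Qed.

(* The elements of [<a :: b>] are uniquely [k a + t], [k < n], [t] in [<b>]. *)
Lemma diff_zeta_cons (n a : nat) b : (0 < n)%N ->
  semigroup b (n * a)%N%:Z ->
  (forall (k : nat) t, semigroup b t -> semigroup b (t + (k * a)%N%:Z) ->
     (n %| k)%N) ->
  diff a (zeta (semigroup (a :: b))) = diff (n * a) (zeta (semigroup b)).
Proof.
move=> n0 bna bdvd; apply/funext => x; rewrite /diff /zeta.
set T := semigroup b; set S := semigroup (a :: b).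
have SE : (x \in S) = (x \in T) || (x - a%:Z \in S).
  apply/idP/orP; rewrite !in_setE.
    case/semigroup_cons; case=> [|k].
      by rewrite subr0; left.
    move=> H; right; apply/semigroup_cons; exists k; move: H.
    by congr (semigroup b _); lia.
  case=> [H|/semigroup_cons[k H]]; apply/semigroup_cons.
    by exists 0%N; rewrite subr0.
  exists k.+1; move: H; congr (semigroup b _); lia.
(* For the converse: if [x] and [x - (k + 1) a] lie in [T], then [k + 1 = m n], and adding [m - 1]
   copies of [n a] to the latter gives [x - n a]. *)
have TE : (x - (n * a)%N%:Z \in T) = (x \in T) && (x - a%:Z \in S).
  apply/idP/andP; rewrite !in_setE.
    move=> H; split; first by have := semigroupD H bna; rewrite subrK.
    apply/semigroup_cons; exists n.-1; move: H.
    congr (semigroup b _); case: (n) n0 => //= m _; lia.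
  case=> xT /semigroup_cons[k H].
  have /dvdnP[m km] : (n %| k.+1)%N.
    by apply: bdvd H _; move: xT; congr (semigroup b _); lia.
  have m0 : (0 < m)%N by case: m km.
  have := semigroupD H (semigroupMn m.-1 bna).
  congr (semigroup b _); case: m km m0 => // m km _ /=.
  have : (k.+1 * a = (m.+1 * n) * a)%N by rewrite km.
  by nia.
(* The indicators of a disjunction and of a conjunction add up to the sum of the two indicators. *)
by rewrite SE TE; case: (x \in T); case: (x - a%:Z \in S).
Qed.

(** * Denumerants and their generating series *)

Lemma denumerant_nil y : denumerant [::] y = (y == 0).
Proof.
rewrite /denumerant; have [->|y0] := eqVneq y 0.
  rewrite (_ : representations _ _ = [set [tuple] : (size (Nil nat)).-tuple nat])
    ?fset_set1 ?cardfs1//.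
  by apply/seteqP; split=> x /=; rewrite /representations/= big_ord0// tuple0.
rewrite (_ : representations _ _ = set0) ?fset_set0 ?cardfs0//.
rewrite -subset0 => x; rewrite /representations/= big_ord0 => /eqP.
by rewrite (negbTE y0).
Qed.

(** One more copy of the first generator: a bijection from the representations of [y - a] to those
    of [y] with nonzero first coefficient. *)
Definition incr_head n (t : n.+1.-tuple nat) : n.+1.-tuple nat :=
  [tuple of (thead t).+1 :: behead t].

Lemma incr_head_inj n : injective (@incr_head n).
Proof.
move=> s t; case/tupleP: s => i s; case/tupleP: t => j t.
move=> /(congr1 val) /= []; rewrite !theadE => ij st.
by apply/val_inj => /=; rewrite st ij.
Qed.

Lemma cons_tuple_inj n (i : nat) :
  injective (fun t : n.-tuple nat => [tuple of i :: t]).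
Proof. by move=> s t /(congr1 val) /= [] /val_inj. Qed.

(** Representations of [y] are split by whether their first coefficient is zero. Positive entries
    make all the sets finite, so that [fset_set] counts them faithfully. *)
Lemma denumerant_cons a b y : all (leq 1) (a :: b) ->
  denumerant (a :: b) y =
  (denumerant b y + denumerant (a :: b) (y - a%:Z))%N.
Proof.
move=> ab0; have b0 : all (leq 1) b by case/andP: ab0.
have fb z := finite_representations z b0.
have fab z := finite_representations z ab0.
rewrite /denumerant.
have -> : representations (a :: b) y =
    (fun t : (size b).-tuple nat => [tuple of 0%N :: t]) @` representations b y
    `|` @incr_head (size b) @` representations (a :: b) (y - a%:Z).
  apply/seteqP; split=> t /=.
    case/tupleP: t => -[|k] t /representations_cons.
      by rewrite mul0n subr0 => ?; left; exists t.
    move=> H; right; exists [tuple of k :: t].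
      apply/representations_cons; move: H.
      by congr (representations b _ t); lia.
    by apply/val_inj.
  case=> -[s H <-].
    by apply/representations_cons; rewrite mul0n subr0.
  move: H; case/tupleP: s => k s /representations_cons H.
  rewrite (_ : incr_head _ = [tuple of k.+1 :: s]); last exact/val_inj.
  by apply/representations_cons; move: H; congr (representations b _ s); lia.
rewrite fset_setU; [|exact: finite_image..].
rewrite !fset_set_image// cardfsU.
rewrite [X in (_ - X)%N](_ : _ = 0%N) ?subn0; last first.
  apply/eqP; rewrite cardfs_eq0; apply/eqP/fsetP => t; rewrite !inE.
  by apply/negP => /andP[/imfsetP[/= u _ ->]] /imfsetP[/= v _] /(congr1 val).
rewrite !card_imfset//; [exact: incr_head_inj|exact: cons_tuple_inj].
Qed.

Lemma denumerant_neq0 b y : denumerant b y != 0%N -> semigroup b y.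
Proof.
apply: contra_neqP => bE; rewrite /denumerant (_ : representations b y = set0).
  by rewrite fset_set0 cardfs0.
by rewrite -subset0 => t bt; apply: bE; exists t.
Qed.

Lemma causal_denumerant b : causal (fun y => (denumerant b y)%:Z).
Proof.
move=> x x0; have [->//|] := eqVneq (denumerant b x) 0%N.
move/denumerant_neq0/semigroup_ge0.
by rewrite leNgt x0.
Qed.

Lemma diff_denumerant a b : all (leq 1) (a :: b) ->
  diff a (fun y => (denumerant (a :: b) y)%:Z) =
  (fun y => (denumerant b y)%:Z).
Proof.
by move=> ab0; apply/funext => y; rewrite /diff denumerant_cons//; lia.
Qed.

(** * Chain counts, and the Moebius function as a convolution inverse *)

Lemma nchains0 S x : nchains S 0 0 x = (x == 0).
Proof.
rewrite /nchains; have [->|x0] := eqVneq x 0.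
  rewrite (_ : chains _ _ _ _ = [set [tuple 0]]) ?fset_set1 ?cardfs1//.
  apply/seteqP; split=> t /=; last by move=> ->; split.
  case=> t0 _ _; apply/val_inj.
  by case/tupleP: t t0 => i t /= ->; rewrite tuple0.
rewrite (_ : chains _ _ _ _ = set0) ?fset_set0 ?cardfs0//.
by rewrite -subset0 => t [-> /esym/eqP]; rewrite (negbTE x0).
Qed.

Lemma nchains_eq0 (S : set int) l (x : int) :
  (forall s, S s -> 0 <= s) -> x < l%:Z ->
  nchains S l 0 x = 0%N.
Proof.
move=> S0 xl; suff E : chains S l 0 x = set0.
  by rewrite /nchains E fset_set0 cardfs0.
rewrite -subset0 => z zc.
have [_ h] := chain_bound S0 zc (leq0n l).
have z0 : z`_0 = 0 by case: zc.
by move: h; rewrite z0 add0r subn0 leNgt xl.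
Qed.

Lemma rcons_tuple_inj n (i : int) :
  injective (fun t : n.-tuple int => [tuple of rcons t i]).
Proof.
by move=> s t /(congr1 val) /= /eqP; rewrite eqseq_rcons => /andP[/eqP/val_inj].
Qed.

(** Chains are sorted by their last step [i], a positive element of [S]; it is below [n] because the
    penultimate entry is nonnegative. *)
Lemma nchainsS (S : set int) l (x : int) (n : nat) :
  (forall s, S s -> 0 <= s) -> x < n%:Z ->
  nchains S l.+1 0 x =
  (\sum_(i < n | (0 < i)%N && (i%:Z \in S)) nchains S l 0 (x - i%:Z))%N.
Proof.
move=> S0 xn.
pose C := fset_set (chains S l.+1 0 x).
have CP z : z \in C = (z \in chains S l.+1 0 x).
  by rewrite in_fset_set//; exact: finite_chains.
have slt_step w : slt S w x ->
    exists2 i : nat, w = x - i%:Z & (0 < i)%N && (i%:Z \in S).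
  case=> wS wx; have w0 := S0 _ wS; exists `|x - w|%N; first by lia.
  by rewrite gez0_abs// mem_set// andbT; lia.
have lastC z : z \in C -> slt S z`_l x.
  by rewrite CP in_setE => -[_ <-]; apply.
have lastC_ge0 z : z \in C -> 0 <= z`_l.
  rewrite CP in_setE => zC; have [h _] := chain_bound S0 zC (leqnSn l).
  by apply: le_trans h.
rewrite /nchains -/C card_fset_sum1.
transitivity (\sum_(z <- C) \sum_(i < n | (0 < i)%N && (i%:Z \in S))
    ((z`_l)%R == (x - i%:Z)%R))%N.
  apply: eq_big_seq => z zC.
  have [i zi iS] := slt_step _ (lastC _ zC).
  have i_n : (i < n)%N by have := lastC_ge0 _ zC; lia.
  rewrite (bigD1 (Ordinal i_n))//= zi eqxx big1 ?addn0// => j /andP[_ ji].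
  apply/eqP; rewrite eqb0; apply: contra_neqN ji => /eqP xij.
  by apply/val_inj => /=; lia.
rewrite exchange_big/=; apply: eq_bigr => i /andP[i0 iS].
transitivity (\sum_(z <- C | (z`_l)%R == (x - i%:Z)%R) 1)%N.
  by rewrite [RHS]big_mkcond; apply: eq_bigr => z _; case: eqP.
rewrite big_fset_condE/= -card_fset_sum1.
(* Appending [x] is a bijection from the chains ending at [x - i] to the longer chains with
   penultimate entry [x - i]. *)
have -> : [fset z in C | z`_l == x - i%:Z]%fset =
    fset_set ((fun t : l.+1.-tuple int => [tuple of rcons t x]) @`
      chains S l 0 (x - i%:Z)).
  apply/fsetP => z; rewrite !inE/= [RHS]in_fset_set; last first.
    by apply: finite_image; exact: finite_chains.
  rewrite CP; apply/andP/idP; rewrite !in_setE /=.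
    case: z => z; case/lastP: z => // s y sz.
    have ss : size s == l.+1 by move: (sz); rewrite size_rcons.
    have nths k : (k <= l)%N -> (rcons s y)`_k = s`_k.
      by rewrite nth_rcons (eqP ss) ltnS => ->.
    case=> -[/= z0 zl zlt] /eqP zx.
    have yx : y = x by rewrite -zl nth_rcons (eqP ss) ltnn eqxx.
    exists (Tuple ss); last by apply/val_inj; rewrite /= yx.
    split=> [||k kl] /=; first by rewrite -nths.
      by rewrite -nths.
    by rewrite -!nths ?(ltnW kl)//; apply: zlt; apply: ltnW.
  case=> t [t0 tl tlt] <- /=.
  have nths k : (k <= l)%N -> (rcons t x)`_k = t`_k.
    by rewrite nth_rcons size_tuple ltnS => ->.
  have tx : (rcons t x)`_l.+1 = x by rewrite nth_rcons size_tuple ltnn eqxx.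
  split; last by rewrite nths// tl.
  split=> [||k]; [by rewrite nths|by []|].
  rewrite ltnS leq_eqVlt => /orP[/eqP ->|kl].
    rewrite tx nths// tl; split; last by lia.
    by rewrite /sle subKr -in_setE.
  by rewrite !nths ?(ltnW kl)//; apply: tlt.
rewrite fset_set_image ?card_imfset//=; last exact: finite_chains.
exact: rcons_tuple_inj.
Qed.

Lemma mobius_sum (S : set int) (x : int) (n : nat) :
  (forall s, S s -> 0 <= s) -> x < n%:Z ->
  mobius S x = \sum_(l < n) (-1) ^+ l * (nchains S l 0 x)%:Z.
Proof.
move=> S0 xn.
rewrite (fsbig_ord _ n (fun l => (-1) ^+ l * (nchains S l 0 x)%:Z)).
rewrite /mobius; apply/esym/fsbig_widen => // l [_ /= /negP].
by rewrite -leqNgt => nl; rewrite nchains_eq0 ?mulr0//; lia.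
Qed.

Lemma causal_mobius (S : set int) :
  (forall s, S s -> 0 <= s) -> causal (mobius S).
Proof. by move=> S0 x x0; rewrite (@mobius_sum _ _ 0%N)// big_ord0. Qed.

(** The term [i = 0] is the Moebius function at [x]. Expanded by chain length, its part [l = 0] is
    [delta], and the longer chains, sorted by last step, cancel the terms [i > 0]. *)
Lemma conv_zeta_mobius (S : set int) : (forall s, S s -> 0 <= s) -> S 0 ->
  conv (zeta S) (mobius S) = delta.
Proof.
move=> Sge0 S0; apply/funext => x; rewrite /conv big_ord_recl.
set n := `|x|.+1; have xn : x < n%:Z by lia.
(* The bound [n.+1] leaves [n] lengths once [l = 0] is split off, the range used below for each
   [x - i]. *)
rewrite {1}/zeta mem_set// mul1r subr0 (@mobius_sum _ _ n.+1)//; last by lia.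
rewrite big_ord_recl expr0 mul1r nchains0 -addrA.
rewrite -[RHS]addr0; congr (_ + _); first by rewrite /delta; case: eqP.
rewrite [X in X + _](_ : _ =
    - \sum_(i < n | (0 < i)%N && (i%:Z \in S)) mobius S (x - i%:Z)); last first.
  have muE (i : 'I_n) : mobius S (x - i%:Z) =
      \sum_(l < n) (-1) ^+ l * (nchains S l 0 (x - i%:Z))%:Z.
    by apply: mobius_sum => //; lia.
  under [in RHS]eq_bigr do rewrite muE.
  rewrite exchange_big/= -sumrN; apply: eq_bigr => l _.
  rewrite (@nchainsS _ _ _ n)//.
  rewrite exprS mulN1r mulNr -big_distrr/=; congr (- (_ * _)).
  by rewrite (big_morph Posz PoszD erefl).
rewrite big_mkcond big_ord_recl/= add0r.
rewrite [X in - X + _](_ : _ = \sum_(i < `|x|%N) zeta S (lift ord0 i)%:Z *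
    mobius S (x - (lift ord0 i)%:Z)) ?addNr//.
apply: eq_bigr => i _; rewrite /zeta.
by case: (_ \in S); rewrite ?mul1r ?mul0r.
Qed.

(** * Arithmetic of residues and gcds *)

Lemma exists_residue (d a : nat) (x : int) : (0 < d)%N -> coprime a d ->
  exists k : nat,
    unique (fun k : nat => (k < d)%N /\ ((k * a)%N%:Z = x %[mod d%:Z])%Z) k.
Proof.
move=> d0 ad.
(* The Bezout coefficient [u] inverts [a] modulo [d], so the residue is [x * u] modulo [d]. *)
have [u [v uv]] := Bezoutz a%:Z d%:Z.
have {}uv : u * a%:Z + v * d%:Z = 1 by rewrite uv /gcdz/= (eqP ad).
have k0 := modz_ge0 (x * u) (_ : d%:Z != 0).
have kd := ltz_pmod (x * u) (_ : 0 < d%:Z).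
exists `|(x * u %% d%:Z)%Z|%N; split.
  split; first by have := k0; have := kd; lia.
  apply/eqP; rewrite PoszM gez0_abs ?k0//; last by lia.
  rewrite modzMml eqz_mod_dvd.
  apply/dvdzP; exists (- (x * v)).
  have -> : x * u * a%:Z = x * (1 - v * d%:Z) by rewrite -uv; ring.
  by ring.
move=> k [k_d /eqP kx].
rewrite (_ : (x * u)%R = k%:Z %[mod d%:Z])%Z; last first.
  apply/eqP; rewrite -modzMml -(eqP kx) modzMml eqz_mod_dvd.
  apply/dvdzP; exists (- (k%:Z * v)).
  have -> : (k * a)%N%:Z * u = k%:Z * (1 - v * d%:Z) by rewrite -uv PoszM; ring.
  by ring.
by rewrite modz_small//; lia.
Qed.

(** If the gcd were 1, then [a1] would lie in [<a2, a3>] and could be dropped. The strict bound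
    makes 1 an admissible residue. *)
Lemma minimal_generators_gcd_gt1 (a1 a2 a3 : nat) :
  (0 < a2)%N -> minimal_generators [:: a1; a2; a3] ->
  semigroup [:: a2; a3] (gcdn a2 a3 * a1)%N%:Z -> (1 < gcdn a2 a3)%N.
Proof.
move=> a2_gt0 [/= /andP[a1N _] min_a].
have : (0 < gcdn a2 a3)%N by rewrite gcdn_gt0 a2_gt0.
rewrite leq_eqVlt => /predU1P[<-|//]; rewrite mul1n => da1_mem.
exfalso; apply: (min_a [:: a2; a3]).
- by move=> x; rewrite !inE => /orP[]->; rewrite ?orbT.
- by move=> /(_ a1); rewrite (negbTE a1N) inE eqxx => /(_ isT).
apply/seteqP; split=> y.
  by move=> H; apply/semigroup_cons; exists 0%N; rewrite subr0.
case/semigroup_cons=> k /semigroupD /(_ (semigroupMn k da1_mem)).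
by rewrite subrK.
Qed.

(** After multiplication by the gcd, the claim is that [b] divides [gcd(k a, k b)]. *)
Lemma dvdn_div_gcd (a b k : nat) : (0 < a)%N -> (b %| k * a)%N ->
  (b %/ gcdn a b %| k)%N.
Proof.
move=> a0 bka; have g0 : (0 < gcdn a b)%N by rewrite gcdn_gt0 a0.
rewrite -(dvdn_pmul2r g0) divnK ?dvdn_gcdr// muln_gcdr dvdn_gcd bka.
exact: dvdn_mull.
Qed.

(** * The Moebius function as a triple difference of the denumerant *)

Section GluedSemigroup.
Variables a1 a2 a3 : nat.
Hypotheses (a1_gt0 : (0 < a1)%N) (a2_gt0 : (0 < a2)%N) (a3_gt0 : (0 < a3)%N).
Hypothesis gcd_a : gcdn a1 (gcdn a2 a3) = 1%N.
Let S := semigroup [:: a1; a2; a3].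
Let d := gcdn a2 a3.
Hypothesis da1_mem : semigroup [:: a2; a3] (d * a1)%N%:Z.
Let B := [:: (d * a1)%N; (a2 * a3 %/ d)%N].

Lemma gcd_gt0 : (0 < d)%N. Proof. by rewrite gcdn_gt0 a2_gt0. Qed.

(** This writes the lcm in the form [n * a] of [diff_zeta_cons], with [a = a2]. *)
Lemma lcm_eq_mul : (a2 * a3 %/ d = a3 %/ d * a2)%N.
Proof. by rewrite -muln_divA ?dvdn_gcdr// mulnC. Qed.

Lemma B_gt0 : all (leq 1) B.
Proof.
rewrite /= andbT muln_gt0 gcd_gt0 a1_gt0/= lcm_eq_mul muln_gt0 a2_gt0 andbT.
by rewrite divn_gt0 ?gcd_gt0// dvdn_leq// dvdn_gcdr.
Qed.

Lemma diff_zeta_S :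
  diff a1 (diff a2 (diff a3 (zeta S))) =
  diff (d * a1) (diff (a2 * a3 %/ d) delta).
Proof.
(* Away from 0, subtracting [a3] does not change membership in [<a3>]. *)
have zeta3 : diff a3 (zeta (semigroup [:: a3])) = delta.
  apply/funext => x; rewrite /diff /zeta /delta.
  have [->|x0] := eqVneq x 0.
    rewrite mem_set; last exact: semigroup0.
    by rewrite memNset ?subr0// => /semigroup_ge0; lia.
  rewrite (_ : (x \in _) = (x - a3%:Z \in semigroup [:: a3])) ?subrr//.
  apply/idP/idP; rewrite !in_setE => /semigroup_cons[k /semigroup_nil xk];
    apply/semigroup_cons.
    by case: k xk => [|k] xk; [lia|exists k; apply/semigroup_nil; lia].
  by exists k.+1; apply/semigroup_nil; lia.
have zeta23 : diff a2 (zeta (semigroup [:: a2; a3])) =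
    diff (a2 * a3 %/ d) (zeta (semigroup [:: a3])).
  rewrite lcm_eq_mul; apply: diff_zeta_cons.
  - by rewrite divn_gt0 ?gcd_gt0// dvdn_leq// dvdn_gcdr.
  - apply/semigroup_cons; exists (a2 %/ d)%N; apply/semigroup_nil.
    by rewrite -lcm_eq_mul mulnC -muln_divA ?dvdn_gcdl// mulnC subrr.
  have dvd3 := @semigroup_dvd a3 [:: a3] _.
  move=> k t /dvd3; rewrite /= dvdnn => /(_ isT) a3t /dvd3.
  rewrite /= dvdnn => /(_ isT); rewrite rpredDl//.
  exact: dvdn_div_gcd.
(* Elements of [<a2, a3>] are multiples of [d], so a difference [k a1] of two of them gives [d | k],
   as [a1] is coprime to [d]. *)
have zeta123 : diff a1 (zeta S) = diff (d * a1) (zeta (semigroup [:: a2; a3])).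
  apply: diff_zeta_cons => //; first exact: gcd_gt0.
  have dvdd := @semigroup_dvd d [:: a2; a3] _.
  move=> k t /dvdd; rewrite /= dvdn_gcdl dvdn_gcdr => /(_ isT) dt /dvdd.
  rewrite /= dvdn_gcdl dvdn_gcdr => /(_ isT); rewrite rpredDl//.
  by rewrite dvdzE/= Gauss_dvdl// /coprime gcdnC gcd_a.
rewrite (diffC a2 a3) (diffC a1 a3) (diffC a1 a2) zeta123.
rewrite (diffC a2) zeta23 (diffC a3 (d * a1)).
by rewrite (diffC a3 (a2 * a3 %/ d)) zeta3.
Qed.

Lemma mobius_diff :
  mobius S = diff a1 (diff a2 (diff a3 (fun y => (denumerant B y)%:Z))).
Proof.
have S_ge0 s : S s -> 0 <= s by exact: semigroup_ge0.
have cB := causal_denumerant B.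
have cmu : causal (mobius S) by exact: causal_mobius.
have dB_gt0 : (0 < d * a1)%N by case/andP: B_gt0.
have L_gt0 : (0 < a2 * a3 %/ d)%N by case/and3P: B_gt0.
(* Both sides may be compared after multiplication by the two factors that turn the denumerant into
   [delta]. *)
apply: (diff_inj dB_gt0) => //; first by do 3!apply: causal_diff.
apply: (diff_inj L_gt0); try by do ?apply: causal_diff.
have dB : diff (a2 * a3 %/ d)
    (diff (d * a1) (fun y => (denumerant B y)%:Z)) = delta.
  rewrite (diff_denumerant B_gt0) diff_denumerant; last by case/andP: B_gt0.
  by apply/funext => y; rewrite denumerant_nil /delta; case: eqP.
have -> f : diff (a2 * a3 %/ d)
      (diff (d * a1) (diff a1 (diff a2 (diff a3 f)))) =
    diff a1 (diff a2 (diff a3 (diff (a2 * a3 %/ d) (diff (d * a1) f)))).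
  rewrite (diffC (d * a1)) (diffC (d * a1)) (diffC (d * a1)).
  by rewrite !(diffC (a2 * a3 %/ d)).
(* With [delta] written as zeta times Moebius, the three differences move onto zeta, become two
   there, and move back out. *)
rewrite dB -(conv_zeta_mobius S_ge0 (semigroup0 _)).
have cz : causal (zeta S) by exact: causal_zeta.
rewrite -!conv_diffl//; try by do ?apply: causal_diff.
rewrite diff_zeta_S (diffC (d * a1)).
rewrite !conv_diffl//; try by do ?[apply: causal_diff|apply: causal_delta].
by rewrite conv_delta.
Qed.

Lemma denumerantB_dvd y : denumerant B y != 0%N -> (d%:Z %| y)%Z.
Proof.
move/denumerant_neq0; apply: semigroup_dvd.
by rewrite /= dvdn_mulr// -muln_divA ?dvdn_gcdr// dvdn_mulr// dvdn_gcdl.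
Qed.

End GluedSemigroup.

(** * The closed formula, by the residue of [x] *)

Theorem theorem4p4 (a1 a2 a3 : nat)
    (a1_gt0 : (0 < a1)%N) (a2_gt0 : (0 < a2)%N) (a3_gt0 : (0 < a3)%N)
    (gcd_a : gcdn a1 (gcdn a2 a3) = 1%N)
    (min_a : minimal_generators [:: a1; a2; a3])
    (da1_mem : semigroup [:: a2; a3] (gcdn a2 a3 * a1)%N%:Z) :
  let S := semigroup [:: a1; a2; a3] in
  let d := gcdn a2 a3 in
  let B := [:: (d * a1)%N; (a2 * a3 %/ d)%N] in
  exists alpha : int -> nat,
    (forall x : int,
       unique (fun k : nat => (k < d)%N /\ ((k * a1)%N%:Z = x %[mod d%:Z])%Z)
         (alpha x)) /\
    (forall x : int,
       let x' := x - (alpha x * a1)%N%:Z in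
       ((2 <= alpha x)%N -> mobius S x = 0) /\
       ((alpha x < 2)%N ->
          mobius S x =
            (-1) ^+ alpha x *
            ((denumerant B x')%:Z - (denumerant B (x' - a2%:Z))%:Z
             - (denumerant B (x' - a3%:Z))%:Z
             + (denumerant B (x' - a2%:Z - a3%:Z))%:Z))).
Proof.
move=> S d B.
have d_gt1 : (1 < d)%N by exact: minimal_generators_gcd_gt1 min_a da1_mem.
have [alpha alphaP] : exists alpha : int -> nat, forall x,
    unique (fun k : nat => (k < d)%N /\ ((k * a1)%N%:Z = x %[mod d%:Z])%Z)
      (alpha x).
  have H x := @exists_residue d a1 x (ltnW d_gt1) (introT eqP gcd_a).
  by exists (fun x => projT1 (cid (H x))) => x; exact: (projT2 (cid (H x))).
exists alpha; split=> // x x'.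
have alphaE (k : nat) : (k < d)%N -> (d%:Z %| x - (k * a1)%N%:Z)%Z ->
    alpha x = k.
  move=> kd; rewrite -eqz_mod_dvd => /eqP xk.
  by have [_] := alphaP x; apply; split.
pose g := diff a2 (diff a3 (fun y => (denumerant B y)%:Z)).
have gE y : g y = (denumerant B y)%:Z - (denumerant B (y - a2%:Z))%:Z
             - (denumerant B (y - a3%:Z))%:Z
             + (denumerant B (y - a2%:Z - a3%:Z))%:Z.
  by rewrite /g /diff; ring.
(* Shifts by [a2] and [a3] preserve divisibility by [d], so off the multiples of [d] all four terms
   vanish. *)
have g0 y : ~~ (d%:Z %| y)%Z -> g y = 0.
  have da2 : (d%:Z %| a2%:Z)%Z by exact: dvdn_gcdl.
  have da3 : (d%:Z %| a3%:Z)%Z by exact: dvdn_gcdr.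
  have dvdB z : ~~ (d%:Z %| z)%Z -> denumerant B z = 0%N.
    by apply: contraNeq; apply: denumerantB_dvd.
  by move=> yd; rewrite gE !dvdB ?rpredBr.
have muE : mobius S x = g x - g (x - a1%:Z) by rewrite /S mobius_diff.
(* A nonzero [g x] forces [d | x], hence residue 0; a nonzero [g (x - a1)] forces residue 1, where
   [1 < d] is used. At most one of the two survives, and it is [g] at [x'] up to sign. *)
have x0 : alpha x <> 0%N -> g x = 0.
  move=> ax; apply: g0; apply/negP => dx; apply: ax.
  by apply: alphaE; rewrite ?subr0; lia.
have x1 : alpha x <> 1%N -> g (x - a1%:Z) = 0.
  move=> ax; apply: g0; apply/negP => dx; apply: ax.
  by apply: alphaE; rewrite ?mul1n.
rewrite -gE muE; split=> [a2x|]; first by rewrite x0 ?x1 ?subrr//; lia.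
rewrite /x'; case: (alpha x) x0 x1 => [|[|//]] x0 x1 _.
  by rewrite x1// mul0n !subr0 expr0 mul1r.
by rewrite x0// mul1n sub0r expr1 mulN1r.
Qed.
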